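(* Let $n\ge2$, let $P$ be an admissible polynomial $n$-tuple and let $m\in\mathbb N^n$. Then the linear transformation $\Psi:\mathscr H^2_m(\triangle^n_P)\to\mathscr H^2_m(\mathbb D^n_{\widetilde P})$ given by $$\Psi(f)=J_{\varphi^{-1}}\cdot f\circ\varphi^{-1},\qquad f\in\mathscr H^2_m(\triangle^n_P),$$ defines a unitary transformation. Moreover, if $\mathscr M_z$ and $\widetilde{\mathscr M}_z$ are the multiplication $n$-tuples on $\mathscr H^2_m(\triangle^n_P)$ and $\mathscr H^2_m(\mathbb D^n_{\widetilde P})$, respectively, then $$\Psi\,\mathscr M_{z_j}=\Big(\prod_{k=j}^n\widetilde{\mathscr M}_{z_k}\Big)\Psi,\qquad j=1,\ldots,n.$$
   Context: $\mathbb N$ = positive integers, $\mathbb C_*=\mathbb C\setminus\{0\}$, $\varepsilon_j$ = $j$-th standard basis vector, $z\diamond w=(z_1w_1,\ldots,z_nw_n)$, $\overline z$ = entrywise conjugate. An admissible polynomial $n$-tuple is $P=(P_1,\ldots,P_n)$ in $\mathbb C[z_1,\ldots,z_n]$ such that each $P_j$ has nonnegative coefficients, zero constant term, linear part $a_jz_j$ with $a_j>0$, and depends on the variable $z_j$ alone. Let $\varphi(z)=\big(\frac{z_1}{z_2},\ldots,\frac{z_{n-1}}{z_n},z_n\big)$ on $\mathbb C\times\mathbb C_*^{n-1}$, with inverse $\varphi^{-1}(z)=\big(\prod_{j=1}^nz_j,\ldots,\prod_{j=n-1}^nz_j,z_n\big)$, whose Jacobian is $J_{\varphi^{-1}}(z)=\prod_{j=2}^nz_j^{j-1}$.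 Let $\triangle^n_P=\{z\in\mathbb C\times\mathbb C_*^{n-1}:P_j(\varphi(z)\diamond\overline{\varphi(z)})<1,\ j=1,\ldots,n\}$, and let $\mathscr H^2_m(\triangle^n_P)$ be the reproducing kernel Hilbert space of holomorphic functions on $\triangle^n_P$ with kernel $$\mathscr K_{P,m}(z,w)=\prod_{j=2}^n\frac1{z_j\overline w_j}\prod_{j=1}^n\frac1{\big(1-P_j(\varphi(z)\diamond\overline{\varphi(w)})\big)^{m_j}}.$$ Put $\widetilde P_j(s)=P_j(s\varepsilon_j)$ for $s\in\mathbb C$, $\mathbb D_{\widetilde P_j}=\{s\in\mathbb C:|\widetilde P_j(|s|^2)|<1\}$ (an open disc centered at $0$), and $\mathbb D^n_{\widetilde P}=\mathbb D_{\widetilde P_1}\times\cdots\times\mathbb D_{\widetilde P_n}$. $\mathscr H^2_m(\mathbb D^n_{\widetilde P})$ is the reproducing kernel Hilbert space on $\mathbb D^n_{\widetilde P}$ with kernel $\prod_{j=1}^n(1-\widetilde P_j(z_j\overline w_j))^{-m_j}$. The coordinate functions are multipliers of both spaces; $\mathscr M_{z_j}$ and $\widetilde{\mathscr M}_{z_j}$ are the corresponding bounded multiplication operators. The function $J_{\varphi^{-1}}\cdot f\circ\varphi^{-1}$ is initially defined on $\varphi(\triangle^n_P)=\mathbb D_{\widetilde P_1}\times(\mathbb D_{\widetilde P_2}\setminus\{0\})\times\cdots\times(\mathbb D_{\widetilde P_n}\setminus\{0\})$ and is understood as its holomorphic extension to $\mathbb D^n_{\widetilde P}$. *)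

(* Defs.v *)
From HB Require Import structures.
From mathcomp Require Import all_boot all_order all_algebra sesquilinear.
From mathcomp Require Import complex.
From mathcomp Require Import all_classical all_reals all_analysis.
(* Not imported: the notations of mpoly clash with those of MathComp-Analysis. *)
From mathcomp Require mpoly.

Set Implicit Arguments.
Unset Strict Implicit.
Unset Printing Implicit Defensive.

Import Order.TTheory GRing.Theory Num.Theory.
Import numFieldNormedType.Exports.
Local Open Scope classical_set_scope.
Local Open Scope ring_scope.

(* The complex numbers R[i], wrapped so that MathComp-Analysis' topological
   and normed-module instances for an arbitrary numClosedFieldType apply. In
   the order of R[i], [x < y] means that y - x is a positive real. *)
Definition cplx (R : realType) : numClosedFieldType := R[i]%C.

(* Complex (Fréchet) differentiability. The sets D used below are open, so the
   values of g outside D are irrelevant. *)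
Definition holomorphic_on (R : realType) (n : nat) (D : set 'rV[cplx R]_n)
    (g : 'rV[cplx R]_n -> cplx R) : Prop :=
  forall z, D z -> differentiable g z.

Definition is_holomorphic_extension (R : realType) (n : nat)
    (E D : set 'rV[cplx R]_n) (h g : 'rV[cplx R]_n -> cplx R) : Prop :=
  [/\ holomorphic_on D g,
      (forall z, E z -> g z = h z) &
      forall g' : 'rV[cplx R]_n -> cplx R,
        holomorphic_on D g' -> (forall z, E z -> g' z = h z) ->
        forall z, D z -> g' z = g z].

(* A reproducing kernel Hilbert space of functions on X with kernel K. An
   element f of the carrier stands for the function [rkhs_eval f] on X; the
   values of [rkhs_eval f] outside X are unconstrained. [rkhs_dot] is linear in
   its first argument and conjugate-linear in the second. *)
Record rkhs (R : realType) (T : Type) (X : set T) (K : T -> T -> cplx R) :=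
  RKHS {
  rkhs_space :> completeNormedModType (cplx R);
  rkhs_dot : {dot rkhs_space for @Num.conj (cplx R)};
  rkhs_dot_norm : forall f, rkhs_dot f f = `|f| ^+ 2;
  rkhs_eval : rkhs_space -> T -> cplx R;
  rkhs_eval_linear : forall (a : cplx R) (f g : rkhs_space) (z : T), X z ->
    rkhs_eval (a *: f + g) z = a * rkhs_eval f z + rkhs_eval g z;
  rkhs_eval_inj : forall f g : rkhs_space,
    (forall z, X z -> rkhs_eval f z = rkhs_eval g z) -> f = g;
  rkhs_reproducing : forall w, X w ->
    exists2 k : rkhs_space, (forall z, X z -> rkhs_eval k z = K z w) &
      forall f : rkhs_space, rkhs_eval f w = rkhs_dot f k
}.

Definition is_unitary_op (R : realType) (T1 T2 : Type)
    (X1 : set T1) (X2 : set T2)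
    (K1 : T1 -> T1 -> cplx R) (K2 : T2 -> T2 -> cplx R)
    (H1 : rkhs X1 K1) (H2 : rkhs X2 K2) (U : {linear H1 -> H2}) : Prop :=
  bijective U /\
  forall f g : H1, rkhs_dot H2 (U f) (U g) = rkhs_dot H1 f g.

(* M is the bounded operator of multiplication by the function s. *)
Definition is_mult_op (R : realType) (T : Type) (X : set T)
    (K : T -> T -> cplx R) (H : rkhs X K) (s : T -> cplx R)
    (M : {linear H -> H}) : Prop :=
  (exists c : cplx R, forall f : H, `|M f| <= c * `|f|) /\
  forall (f : H) (z : T), X z -> rkhs_eval (M f) z = s z * rkhs_eval f z.

Definition admissible (R : realType) (n : nat)
    (P : 'I_n -> mpoly.mpoly n (cplx R)) : Prop :=
  forall j : 'I_n,
  [/\ (forall a : mpoly.multinom n, 0 <= mpoly.mcoeff a (P j)),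
      mpoly.mcoeff (mpoly.mnm0 (n := n)) (P j) = 0,
      (forall i : 'I_n, i != j -> mpoly.mcoeff (mpoly.mnm1 i) (P j) = 0),
      0 < mpoly.mcoeff (mpoly.mnm1 j) (P j) &
      (forall a : mpoly.multinom n, mpoly.mcoeff a (P j) != 0 ->
         forall i : 'I_n, i != j -> mpoly.fun_of_multinom a i = 0%N)].

Definition conj_row (R : realType) (n : nat) (z : 'rV[cplx R]_n) :
    'rV[cplx R]_n :=
  \row_j (z 0 j)^*.

Definition diamond (R : realType) (n : nat) (z w : 'rV[cplx R]_n) :
    'rV[cplx R]_n :=
  \row_j (z 0 j * w 0 j).

Definition peval (R : realType) (n : nat) (p : mpoly.mpoly n (cplx R))
    (z : 'rV[cplx R]_n) : cplx R :=
  mpoly.meval (z 0) p.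

(* Indices start at 0: the coordinate z_j of the mathematics is [z 0 i] with
   i = j - 1. [insub i.+1] is [None] exactly for the last index. Division by 0
   only occurs outside C * (C \ {0})^(n-1). *)
Definition phi (R : realType) (n : nat) (z : 'rV[cplx R]_n) : 'rV[cplx R]_n :=
  \row_(j < n)
    (if insub j.+1 is Some k then z 0 j / z 0 (k : 'I_n) else z 0 j).

Definition phi_inv (R : realType) (n : nat) (z : 'rV[cplx R]_n) :
    'rV[cplx R]_n :=
  \row_(j < n) \prod_(k < n | (j <= k)%N) z 0 k.

(* Complex Jacobian determinant of phi_inv; see [jac_phi_invE]. *)
Definition jac_phi_inv (R : realType) (n : nat) (z : 'rV[cplx R]_n) : cplx R :=
  \det (\matrix_(j < n, k < n)
    'D_(delta_mx 0 k) (fun w : 'rV[cplx R]_n => phi_inv w 0 j : cplx R) z).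

Definition triangle (R : realType) (n : nat)
    (P : 'I_n -> mpoly.mpoly n (cplx R)) : set 'rV[cplx R]_n :=
  [set z : 'rV[cplx R]_n | (forall j : 'I_n, (0 < j)%N -> z 0 j != 0) /\
           (forall j : 'I_n,
              peval (P j) (diamond (phi z) (conj_row (phi z))) < 1)].

Definition triangle_kernel (R : realType) (n : nat)
    (P : 'I_n -> mpoly.mpoly n (cplx R)) (m : 'I_n -> nat)
    (z w : 'rV[cplx R]_n) : cplx R :=
  (\prod_(j < n | (0 < j)%N) (z 0 j * (w 0 j)^*)^-1) *
  \prod_(j < n)
    ((1 - peval (P j) (diamond (phi z) (conj_row (phi w)))) ^+ m j)^-1.

Definition Ptilde (R : realType) (n : nat)
    (P : 'I_n -> mpoly.mpoly n (cplx R)) (j : 'I_n) (s : cplx R) : cplx R :=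
  peval (P j) (s *: delta_mx 0 j).

Definition disc (R : realType) (n : nat)
    (P : 'I_n -> mpoly.mpoly n (cplx R)) (j : 'I_n) : set (cplx R) :=
  [set s | `|Ptilde P j (`|s| ^+ 2)| < 1].

Definition polydisc (R : realType) (n : nat)
    (P : 'I_n -> mpoly.mpoly n (cplx R)) : set 'rV[cplx R]_n :=
  [set z : 'rV[cplx R]_n | forall j : 'I_n, disc P j (z 0 j)].

Definition polydisc_kernel (R : realType) (n : nat)
    (P : 'I_n -> mpoly.mpoly n (cplx R)) (m : 'I_n -> nat)
    (z w : 'rV[cplx R]_n) : cplx R :=
  \prod_(j < n) ((1 - Ptilde P j (z 0 j * (w 0 j)^*)) ^+ m j)^-1.

Lemma derive_prod_coord (R : realType) (n : nat) (Q : pred 'I_n) (k : 'I_n)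
    (z : 'rV[cplx R]_n) :
  'D_(delta_mx 0 k) (fun w : 'rV[cplx R]_n => \prod_(l < n | Q l) w 0 l) z =
  if Q k then \prod_(l < n | Q l && (l != k)) z 0 l else 0 :> cplx R.
Proof.
apply: lim_near_cst => //=; near=> h.
have h0 : h != 0 by near: h; exact: (@nbhs_dnbhs_neq (cplx R)).
have lk (l : 'I_n) : l != k ->
    (h *: (delta_mx 0 k : 'rV[cplx R]_n) + z) 0 l = z 0 l.
  by move=> /negPf lk; rewrite !mxE lk andbF mulr0 add0r.
case: ifPn => Qk; last first.
  rewrite (eq_bigr (fun l => z 0 l)) ?subrr ?scaler0// => l Ql.
  by apply: lk; apply: contraNneq Qk => <-.
rewrite (bigD1 k)//= [X in _ - X](bigD1 k)//=.
rewrite (eq_bigr (fun l => z 0 l)) => [|l /andP[_ /lk]//].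
rewrite !mxE !eqxx mulr1 -mulrBl addrK.
by rewrite [LHS]mulrA mulVf ?mul1r.
Unshelve. all: by end_near. Qed.

Lemma jac_phi_invE (R : realType) (n : nat) (z : 'rV[cplx R]_n) :
  jac_phi_inv z = \prod_(j < n) z 0 j ^+ j.
Proof.
rewrite /jac_phi_inv.
have -> : (\matrix_(j < n, k < n)
    'D_(delta_mx 0 k) (fun w : 'rV[cplx R]_n => phi_inv w 0 j : cplx R) z) =
  \matrix_(j < n, k < n)
    (if (j <= k)%N then \prod_(l < n | (j <= l)%N && (l != k)) z 0 l else 0).
  apply/matrixP => j k; rewrite !mxE -derive_prod_coord.
  by congr ('D_ _ _ z); apply/funext => w; rewrite mxE.
rewrite -det_tr det_trig; last first.
  by apply/is_trig_mxP => j k jk; rewrite !mxE leqNgt jk.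
under eq_bigr => j _ do rewrite !mxE leqnn.
rewrite (exchange_big_dep predT)//=; apply: eq_bigr => l _.
rewrite prodr_const; congr (_ ^+ _).
rewrite (eq_card (B := [pred j : 'I_n | (j < l)%N])); last first.
  by move=> j; rewrite !inE /in_mem/= ltn_neqAle andbC eq_sym.
rewrite -sum1_card (big_ord_narrow (ltnW (ltn_ord l)))/=.
by rewrite sum1_card card_ord.
Qed.

(* Main.v *)
(* Write J for the Jacobian of phi^-1. Since J(z) is the product of the
   coordinates of index at least 2 of phi^-1(z), the kernels are related by
   J(z) conj(J(w)) K1(phi^-1(z), phi^-1(w)) = K2(z, w) on E = phi(triangle).
   Hence the kernel functions of the first space at the points phi^-1(z) and
   the kernel functions of the second space at z in E, scaled by
   conj(J(z))^-1, have the same Gram matrix; both families are total, so there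
   is a unitary Psi exchanging them, and the reproducing property reads
   Psi(f) = J (f o phi^-1) on E.
   Totality of the second family amounts to: an element of the second space
   that vanishes on the dense set E is 0. This follows from the holomorphy of
   the elements f of that space. On the one hand the kernel functions are
   rational; on the other hand the second difference
   K(w+h,w+h) - K(w+h,w) - K(w,w+h) + K(w,w), which is the squared norm of
   k_{w+h} - k_w, is O(|h|^2), so that |f(w+h) - f(w)| <= C |f| |h|; hence the
   functions that are differentiable at w form a closed subspace, which
   contains the kernel functions. *)

Require Import Defs.
From HB Require Import structures.
From mathcomp Require Import all_boot all_order all_algebra sesquilinear.
From mathcomp Require Import complex.
From mathcomp Require Import all_classical all_reals all_analysis.
From mathcomp Require Import ring.
From mathcomp Require mpoly.

Set Implicit Arguments.
Unset Strict Implicit.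
Unset Printing Implicit Defensive.

Import Order.TTheory GRing.Theory Num.Theory.
Import numFieldNormedType.Exports.
Local Open Scope classical_set_scope.
Local Open Scope ring_scope.

(** * Hilbert spaces over R[i] *)

Section ball_intersection.
Variable R : realType.
Local Notation C := (cplx R).

(* The intervals of centre x t and radius r t meet pairwise. *)
Lemma real_interval_helly (T : Type) (t0 : T) (x r : T -> R) :
  (forall s t, x s - x t <= r s + r t) -> exists l, forall t, `|x t - l| <= r t.
Proof.
(* The left endpoints all lie below every right endpoint, so their supremum lies in every
   interval. *)
move=> xr; pose S := [set x t - r t | t in [set: T]].
have S0 : S !=set0 by exists (x t0 - r t0); exists t0.
have ubS t : ubound S (x t + r t).
  by move=> _ [s _ <-]; rewrite lerBlDr -addrA -lerBlDl [r t + _]addrC.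
exists (sup S) => t; rewrite ler_distlC; apply/andP; split.
  by apply: (ub_le_sup (ex_intro _ _ (ubS t))); exists t.
exact: ge_sup S0 (ubS t).
Qed.

(* Balls need not satisfy Helly's property: intersecting the real and the
   imaginary parts separately costs the factor 2. *)
Lemma complex_ball_helly (T : Type) (t0 : T) (c e : T -> C) :
  (forall t, 0 <= e t) -> (forall s t, `|c s - c t| <= e s + e t) ->
  exists l, forall t, `|c t - l| <= 2 * e t.
Proof.
move=> e0 ce.
have eE t : e t = (complex.Re (e t : R[i]))%:C%C.
  by rewrite complex.RRe_real//; exact: ger0_real.
have part (f : R[i] -> R) : {morph f : x y / x - y} ->
    (forall z : R[i], `|f z|%:C%C <= `|z|) ->
    exists l, forall t, `|f (c t) - l|%:C%C <= e t.
  move=> fB fle.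
  have [l lP] : exists l, forall t, `|f (c t) - l| <= complex.Re (e t : R[i]).
    apply: (real_interval_helly t0) => s t.
    have : `|f (c s - c t)|%:C%C <= e s + e t.
      exact: le_trans (fle _) (ce s t).
    rewrite fB [in X in X -> _](eE s) [in X in X -> _](eE t) -rmorphD.
    by rewrite complex.lecR; exact/le_trans/ler_norm.
  by exists l => t; rewrite [leRHS]eE complex.lecR.
have [a aP] := part (@complex.Re R) ltac:(by case=> ? ? []) (@complex.normc_ge_Re R).
have [|b bP] := part (@complex.Im R) ltac:(by case=> ? ? []).
  case=> u v; rewrite complex.normc_def/= complex.lecR -sqrtr_sqr.
  by rewrite ler_wsqrtr// lerDr sqr_ge0.
exists (a +i* b)%C => t; rewrite mulr_natl mulr2n.
have -> : c t - (a +i* b)%C = (complex.Re (c t : R[i]) - a)%:C%C +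
    'i%C * (complex.Im (c t : R[i]) - b)%:C%C :> R[i].
  by case: (c t) => u v; apply/eqP; rewrite complex.eq_complex/=; apply/andP;
    split; apply/eqP; ring.
apply: le_trans (ler_normD _ _) _; apply: lerD.
  apply: le_trans (aP t); rewrite complex.normc_def/= complex.lecR.
  by rewrite expr0n addr0 sqrtr_sqr.
apply: le_trans (bP t); rewrite normrM [X in X * _]complex.normc_def/=.
rewrite expr0n add0r expr1n sqrtr1 mul1r complex.normc_def/= complex.lecR.
by rewrite expr0n addr0 sqrtr_sqr.
Qed.

(* Completeness, in a form that makes no use of sequences: the index t stands
   for an approximation of the limit with error at most e t. *)
Lemma complete_ball_helly (H : completeNormedModType C) (T : Type)
    (c : T -> H) (e : T -> C) :
  (forall t, 0 <= e t) -> (forall s t, `|c s - c t| <= e s + e t) ->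
  (forall eps, 0 < eps -> exists t, e t < eps) ->
  exists l, forall t, `|c t - l| <= e t.
Proof.
move=> e0 ce einf; have [t0 _] := einf 1 ltr01.
(* Nonnegative errors are pairwise comparable, so the sets of points with error at most [e s] are
   nested and form a filter base. *)
pose F := filter_from [set: T] (fun s => [set c t | t in [set t | e t <= e s]]).
have FF : ProperFilter F.
  apply: filter_from_proper; last by move=> s _; exists (c s); exists s => /=.
  apply: filter_from_filter; first by exists t0.
  move=> s t _ _.
  have [st|ts] := real_leP (ger0_real (e0 s)) (ger0_real (e0 t)).
    exists s => // _ [u us <-]; split; exists u => //=.
    exact: le_trans us st.
  exists t => // _ [u us <-]; split; exists u => //=.
  exact: le_trans us (ltW ts).
have /cauchy_cvg Fl : cauchy F.
  apply: cauchy_exP => eps eps0.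
  have [s es] := einf (eps / 2) (divr_gt0 eps0 (ltr0n _ 2)).
  exists (c s), s => // _ [t /= ts <-]; rewrite -ball_normE /=.
  apply: le_lt_trans (ce s t) _; rewrite [eps]splitr.
  by apply: ltrD => //; apply: le_lt_trans es.
exists (lim F) => t; apply/ler_addgt0Pr => eps eps0.
have eps20 : 0 < eps / 2 by rewrite divr_gt0.
have [s es] := einf _ eps20.
have /= := Fl (ball (lim F) (eps / 2)) (nbhsx_ballx _ _ eps20).
case=> u _ uball.
(* A point [c v] with error at most both [e s] and [e u] is within [eps / 2] of the limit and within
   [e t + eps / 2] of [c t]. *)
have [v vs vu] : exists2 v, e v <= e s & e v <= e u.
  have [su|us] := real_leP (ger0_real (e0 s)) (ger0_real (e0 u)); first by exists s.
  by exists u => //; exact: ltW.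
have /= := uball _ (ex_intro2 _ _ v vu erefl); rewrite -ball_normE /= => lv.
apply: le_trans (ler_distD (c v) _ _) _.
rewrite [eps]splitr addrA; apply: lerD; last by rewrite distrC ltW.
apply: le_trans (ce t v) _; rewrite lerD2l.
exact: le_trans vs (ltW es).
Qed.
End ball_intersection.

(** * Orthogonality and closed subspaces *)

Section hilbert.
Variable R : realType.
Local Notation C := (cplx R).

Section inner_product.
Variables (H : completeNormedModType C) (dot : {dot H for @Num.conj C}).
Hypothesis dot_norm : forall f, dot f f = `|f| ^+ 2.

(** For [b != 0], the hypothesis at the projection coefficient [dot x b / |b|^2] is already this
    bound. It makes the remainder left by an almost nearest point almost orthogonal to [b]. *)
Lemma dot_le_of_almost_minimal (x b : H) (E : C) :
  (forall t, `|x| ^+ 2 - E <= `|x - t *: b| ^+ 2) ->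
  `|dot x b| ^+ 2 <= E * `|b| ^+ 2.
Proof.
have [->|b0] := eqVneq b 0.
  by move=> _; rewrite linear0r normr0 expr0n normr0 expr0n mulr0.
have bb0 : `|b| ^+ 2 != 0 by rewrite expf_neq0// normr_eq0.
move=> /(_ (dot x b / `|b| ^+ 2)); rewrite -!dot_norm.
set D := dot x b; set N := dot b b.
have N0 : 0 <= N by exact: dnorm_ge0.
have NJ : N^* = N by rewrite conj_Creal// ger0_real.
have Nn0 : N != 0 by rewrite dnorm_eq0.
rewrite (dnormB dot) dnormZ linearZr_LR /= -/D -/N.
rewrite -addrA lerD2l opprD lerNl -ler_pdivrMr ?lt_def ?Nn0//.
apply: le_trans.
rewrite !normCK !rmorphM/= !fmorphV/= !NJ conjCK.
by rewrite le_eqVlt; apply/orP; left; apply/eqP; field.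
Qed.

Lemma dot_le (x b : H) : `|dot x b| <= `|x| * `|b|.
Proof.
rewrite -(@ler_pXn2r _ 2)// ?nnegrE ?mulr_ge0// exprMn.
(* With the defect [E = |x|^2] the hypothesis is trivial, and Cauchy-Schwarz results. *)
by apply: dot_le_of_almost_minimal => t; rewrite subrr exprn_ge0.
Qed.

(** The midpoint of the remainders of two points of a subspace is again the remainder of a point of
    it, so its norm is bounded below by the distance to the subspace. *)
Lemma parallelogram (x y : H) :
  `|x - y| ^+ 2 = 2 * `|x| ^+ 2 + 2 * `|y| ^+ 2 - 4 * `|2^-1 *: (x + y)| ^+ 2.
Proof.
rewrite -!dot_norm (dnormB dot) dnormZ (dnormD dot) ger0_norm ?invr_ge0//.
by field.
Qed.

(** Projection theorem: the points of [A] almost nearest to [x] converge to some [l] in [A] with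
    [x - l] orthogonal to [A], so that [x = l]. *)
Lemma closed_submodule_full (A : set H) :
  A 0 -> (forall c f g, A f -> A g -> A (c *: f + g)) ->
  (forall x, (forall eps, 0 < eps -> exists2 a, A a & `|x - a| < eps) -> A x) ->
  (forall x, (forall a, A a -> dot x a = 0) -> x = 0) ->
  forall x, A x.
Proof.
move=> A0 Alin Acl Aorth x.
pose N (a : H) : R := complex.Re (`|x - a| ^+ 2 : R[i]).
have NE a : `|x - a| ^+ 2 = (N a)%:C%C.
  by rewrite [RHS]complex.RRe_real//; exact/ger0_real/exprn_ge0.
have N0 a : 0 <= N a by rewrite -complex.ler0c -NE exprn_ge0.
pose S := [set N a | a in A].
have infS : has_inf S.
  by split; [exists (N 0), 0 | exists 0 => _ [a _ <-]].
pose E a : R := N a - inf S.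
have E0 a : A a -> 0 <= E a.
  by move=> Aa; rewrite subr_ge0; apply: ge_inf; [exact: infS.2|exists a].
(* The midpoint of [a] and [b] lies in [A], so the parallelogram law gives
   [|a - b|^2 <= 2 * E a + 2 * E b], which is at most [(e a + e b)^2]. *)
pose e (a : {a | A a}) : C := sqrtC (2 * (E (sval a))%:C%C).
have e0 a : 0 <= e a.
  by rewrite sqrtC_ge0 mulr_ge0// complex.ler0c E0//; exact: svalP.
have eE a : e a ^+ 2 = 2 * (E (sval a))%:C%C by rewrite sqrtCK.
have einf (eps : C) : 0 < eps -> exists a, e a < eps.
  move=> eps0.
  pose r : R := complex.Re (eps ^+ 2 / 2 : R[i]).
  have rE : r%:C%C = eps ^+ 2 / 2.
    by rewrite complex.RRe_real//; apply/ger0_real; rewrite divr_ge0// exprn_ge0// ltW.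
  have r0 : 0 < r by rewrite -complex.ltcR rE divr_gt0// exprn_gt0.
  have [_ [a Aa <-] ar] := inf_adherent r0 infS.
  exists (exist _ a Aa); rewrite -(@ltr_pXn2r _ 2)// ?nnegrE ?(ltW eps0)//.
  rewrite eE /=.
  have : (E a)%:C%C < r%:C%C :> R[i] by rewrite complex.ltcR ltrBlDl.
  by rewrite rE ltr_pdivlMr// mulrC.
have [||l lP] := complete_ball_helly (c := sval) e0.
- move=> [a Aa] [b Ab]; rewrite -(@ler_pXn2r _ 2)// ?nnegrE ?addr_ge0// sqrrD.
  rewrite !eE /=.
  have -> : a - b = (x - b) - (x - a).
    by rewrite opprB [RHS]addrC addrA subrK.
  rewrite parallelogram; set m := 2^-1 *: (1 *: a + b).
  have -> : 2^-1 *: (x - b + (x - a)) = x - m.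
    rewrite /m scale1r addrACA -opprD scalerBr -mulr2n -(scaler_nat 2 x) scalerA.
    by rewrite mulVf ?scale1r// [b + a]addrC.
  have Am : A m by rewrite -[m]addr0; apply: (Alin) => //; exact: (Alin).
  have Em := E0 _ Am; rewrite -complex.ler0c rmorphB/= in Em.
  rewrite !NE /E !rmorphB/= -subr_ge0 mulr2n.
  set ab := e _ * e _.
  rewrite [X in _ <= X](_ : _ = 4 * ((N m)%:C%C - (inf S)%:C%C) + 2 * ab).
    by rewrite addr_ge0// mulr_ge0// mulr_ge0.
  by ring.
- by [].
have Al : A l.
  apply: Acl => eps /einf[a aeps]; exists (sval a); first exact: svalP.
  by rewrite distrC; apply: le_lt_trans aeps.
have -> : x = l; last by [].
(* Split [x - l] at an almost nearest point [a]: [x - a] is almost orthogonal to [b], and [a - l] is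
   short. Either part contributes at most [e a * |b|]. *)
apply/subr0_eq/Aorth => b Ab; apply/eqP; rewrite -normr_le0.
apply/ler_addgt0Pr => eps eps0; rewrite add0r.
have b1 : 0 < 2 * (`|b| + 1) by rewrite mulr_gt0// ltr_wpDl.
have [a aeps] := einf _ (divr_gt0 eps0 b1).
have : e a * (2 * `|b|) <= eps.
  rewrite ltr_pdivlMr// in aeps; apply: le_trans (ltW aeps).
  by rewrite ler_wpM2l// ler_wpM2l// lerDl.
apply: le_trans; rewrite mulrCA mulr_natl mulr2n.
rewrite -(subrK (sval a) x) -addrA linearDl/=.
apply: le_trans (ler_normD _ _) _; apply: lerD; last first.
  apply: le_trans (dot_le _ _) _; exact: ler_wpM2r.
rewrite -(@ler_pXn2r _ 2)// ?nnegrE ?mulr_ge0// exprMn eE.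
apply: le_trans (dot_le_of_almost_minimal (E := (E (sval a))%:C%C) _) _.
  move=> t; rewrite -addrA -opprD [_ + t *: b]addrC !NE -rmorphB/= complex.lecR.
  rewrite /E subKr; apply: ge_inf; first exact: infS.2.
  by exists (t *: b + sval a) => //; apply: Alin => //; exact: svalP.
rewrite ler_wpM2r ?exprn_ge0// ler_peMl ?complex.ler0c ?E0 ?ler1n//.
exact: svalP.
Qed.
End inner_product.
End hilbert.

(** * Unitary operators from equal Gram matrices *)

Section gram.
Variable R : realType.
Local Notation C := (cplx R).

(** In a Hilbert space this amounts to the density of the linear span of the family. *)
Definition total (H : lmodType C) (dot : H -> H -> C) (I : Type) (a : I -> H) :=
  forall x, (forall i, dot x (a i) = 0) -> x = 0.

Lemma total_inj (H : lmodType C) (dot : {dot H for @Num.conj C}) (I : Type)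
    (a : I -> H) x y :
  total dot a -> (forall i, dot x (a i) = dot y (a i)) -> x = y.
Proof.
by move=> ta xy; apply/subr0_eq/ta => i; rewrite linearBl/= xy subrr.
Qed.

Lemma dotC (H : lmodType C) (dot : {dot H for @Num.conj C}) x y :
  dot x y = (dot y x)^*.
Proof. by rewrite [LHS](hermC dot) expr0 mul1r. Qed.

Section transfer.
Variables (H K : completeNormedModType C).
Variables (dH : {dot H for @Num.conj C}) (dK : {dot K for @Num.conj C}).
Hypothesis dH_norm : forall f, dH f f = `|f| ^+ 2.
Hypothesis dK_norm : forall f, dK f f = `|f| ^+ 2.
Variables (I : Type) (a : I -> H) (b : I -> K).

Let matching x y := forall i, dK y (b i) = dH x (a i).

(* The second clause, which quantifies over all matching pairs, is what makes the
   set of the x that have a partner y a closed subspace. *)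
Lemma gram_transfer :
  (forall i j, dH (a i) (a j) = dK (b i) (b j)) -> total dH a ->
  forall x, exists y, matching x y /\
    forall x' y', matching x' y' -> dK y y' = dH x x'.
Proof.
move=> gram ta.
apply: (closed_submodule_full dH_norm).
- by exists 0; split=> [i|x' y' _]; rewrite !linear0l.
- move=> c f g [yf [mf ef]] [yg [mg eg]]; exists (c *: yf + yg); split=> [i|x' y' m'].
    by rewrite !linearPl/= mf mg.
  by rewrite !linearPl/= (ef _ _ m') (eg _ _ m').
- move=> x xcl.
  pose good f y := matching f y /\
    forall x' y', matching x' y' -> dK y y' = dH f x'.
  (* The partners of two good approximations of [x] are as far apart as the approximations
     themselves, so completeness gives a limit [y] of the partners, with error [|x - f|]. *)
  pose T := {fy : H * K | good fy.1 fy.2}.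
  have [||eps /xcl[f [y [mf ef]] xf]|y yP] :=
    @complete_ball_helly R K T (fun t => (sval t).2) (fun t => `|x - (sval t).1|).
  + by [].
  + move=> [[f y] [/= mf ef]] [[g z] [/= mg eg]].
    have mB : matching (f - g) (y - z) by move=> i; rewrite !linearBl/= mf mg.
    have -> : `|y - z| = `|f - g|.
      apply/eqP; rewrite -(@eqrXn2 _ 2)//; apply/eqP.
      rewrite -dK_norm -dH_norm [LHS]linearBl [RHS]linearBl/=.
      by rewrite (ef _ _ mB) (eg _ _ mB).
    by rewrite [`|x - f|]distrC; apply: ler_distD.
  + by exists (exist _ (f, y) (conj mf ef)).
  have key x' y' : (forall t : T, dK (sval t).2 y' = dH (sval t).1 x') ->
      dK y y' = dH x x'.
    move=> tE; apply/subr0_eq/eqP; rewrite -normr_le0.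
    apply/ler_addgt0Pr => eps eps0; rewrite add0r.
    have b1 : 0 < `|y'| + `|x'| + 1 by rewrite ltr_wpDl ?addr_ge0.
    have [f [z [mf ef]] xf] := xcl _ (divr_gt0 eps0 b1).
    have := tE (exist _ (f, z) (conj mf ef)) => /= zE.
    have := yP (exist _ (f, z) (conj mf ef)) => /= zy.
    have -> : dK y y' - dH x x' = dH (f - x) x' - dK (z - y) y'.
      by rewrite !linearBl/= zE; ring.
    rewrite ltr_pdivlMr// in xf; apply: le_trans (ltW xf).
    apply: le_trans (ler_normB _ _) _.
    apply: le_trans (lerD (dot_le dH_norm _ _) (dot_le dK_norm _ _)) _.
    rewrite 2!mulrDr addrC -[leLHS]addr0; apply: lerD; last by rewrite mulr1.
    by apply: lerD; [apply: ler_wpM2r|rewrite distrC].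
  exists y; split=> [i|x' y' m'].
    apply: key => -[[f z] [/= mf _]]; exact: mf.
  by apply: key => -[[f z] [/= _ ef]]; exact: ef.
(* By equality of the Gram matrices each [a i] has the partner [b i], so only 0 is orthogonal to the
   subspace. *)
- move=> x xorth; apply: ta => i; apply: xorth.
  exists (b i); split=> [j|x' y' m']; first by rewrite gram.
  by rewrite dotC [RHS]dotC m'.
Qed.
End transfer.

(** Totality of [b] makes the partner of each [f] unique, hence linear in [f]; exchanging the two
    families gives the inverse. *)
Lemma gram_unitary (H K : completeNormedModType C)
    (dH : {dot H for @Num.conj C}) (dK : {dot K for @Num.conj C})
    (I : Type) (a : I -> H) (b : I -> K) :
  (forall f, dH f f = `|f| ^+ 2) -> (forall f, dK f f = `|f| ^+ 2) ->
  (forall i j, dH (a i) (a j) = dK (b i) (b j)) -> total dH a -> total dK b ->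
  exists U : {linear H -> K},
    [/\ bijective U, forall f g, dK (U f) (U g) = dH f g &
        forall f i, dK (U f) (b i) = dH f (a i)].
Proof.
move=> nH nK gram ta tb.
have [U UP] := choice (gram_transfer nH nK gram ta).
have [V VP] := choice (gram_transfer nK nH (fun i j => esym (gram i j)) tb).
have Ub f i : dK (U f) (b i) = dH f (a i) by have [] := UP f.
have Va f i : dH (V f) (a i) = dK f (b i) by have [] := VP f.
have Ulin : linear U.
  move=> c f g; apply: (total_inj tb) => i.
  by rewrite linearPl/= !Ub linearPl.
pose UL : {linear H -> K} := HB.pack U (GRing.isLinear.Build _ _ _ _ U Ulin).
exists UL; split => //.
- exists V => x.
    by apply: (total_inj ta) => i; rewrite Va /= Ub.
  by apply: (total_inj tb) => i; rewrite /= Ub Va.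
- by move=> f g; have [_ Uf] := UP f; apply: Uf => i; exact: Ub.
Qed.
End gram.

(** * Differentiability in a reproducing kernel space *)

Lemma linear_approx_differentiable (K : numFieldType) (V W : normedModType K)
    (f : V -> W) (D : {linear V -> W}) (x : V) :
  continuous D ->
  (forall eps : K, 0 < eps ->
     \forall h \near 0, `|f (h + x) - f x - D h| <= eps * `|h|) ->
  differentiable f x.
Proof.
move=> Dc fD; have fDo : f \o shift x = cst (f x) + D +o_ 0 id.
  apply/eqaddoP => eps /fD; apply: filterS => h.
  by rewrite !fctE /= opprD addrA.
by apply/diff_locallyP; rewrite (diff_unique Dc fDo).
Qed.

Lemma differentiable_linear_approx (K : numFieldType) (V W : normedModType K)
    (f : V -> W) (x : V) :
  differentiable f x -> forall eps : K, 0 < eps ->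
  \forall h \near 0, `|f (h + x) - f x - 'd f x h| <= eps * `|h|.
Proof.
move=> /diff_locallyP[_ /eqaddoP fD] eps /fD; apply: filterS => h.
by rewrite !fctE /= opprD addrA.
Qed.

Section first_order.
Variables (R : realType) (n : nat).
Local Notation C := (cplx R).
Implicit Types (g : 'rV[C]_n -> C) (w h : 'rV[C]_n) (l : 'I_n -> C).

Lemma coord_le_norm (K : numDomainType) p q (x : 'M[K]_(p, q)) i j :
  `|x i j| <= `|x|.
Proof.
by rewrite [leRHS]/Num.norm/= mx_normE -[leLHS]nngE num_le; exact: (le_bigmax _ _ (i, j)).
Qed.

(** [l] is the gradient of [g] at [w]. Explicit coordinates let the gradient of a limit be found one
    scalar at a time. *)
Definition first_order g w l := forall eps : C, 0 < eps ->
  \forall h \near (0 : 'rV[C]_n),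
    `|g (h + w) - g w - \sum_j h 0 j * l j| <= eps * `|h|.

Lemma first_order_differentiable g w l :
  first_order g w l -> differentiable g w.
Proof.
move=> gl; pose d h := \sum_j h 0 j * l j.
have dlin : linear (d : 'rV[C]_n -> C).
  move=> c x y; rewrite /d scaler_sumr -big_split; apply: eq_bigr => j _.
  by rewrite !mxE mulrDl -mulrA.
pose D : {linear 'rV[C]_n -> C} :=
  HB.pack (d : 'rV[C]_n -> C) (GRing.isLinear.Build _ _ _ _ (d : 'rV[C]_n -> C) dlin).
have Dc : continuous D.
  move=> x; apply: differentiable_continuous.
  rewrite (_ : (D : _ -> _) = \sum_j (fun h => h 0 j * l j)); last first.
    by apply/funext => h; rewrite fct_sumE.
  apply: differentiable_sum => j.
  by apply: differentiableM; [exact: differentiable_coord|exact: differentiable_cst].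
exact: (linear_approx_differentiable (D := D)).
Qed.

Lemma differentiable_first_order g w :
  differentiable g w -> exists l, first_order g w l.
Proof.
move=> gd; exists (fun j => 'd g w (delta_mx 0 j)) => eps eps0.
have := differentiable_linear_approx gd eps0; apply: filterS => h.
rewrite (_ : 'd g w h = \sum_j h 0 j * 'd g w (delta_mx 0 j))//.
rewrite [in LHS](row_sum_delta h) linear_sum; apply: eq_bigr => j _.
by rewrite linearZ.
Qed.

(** Elements of a reproducing kernel space are constrained on [X] only, so identities between their
    values are available just near [w]. *)
Lemma first_order_near g1 g2 w l :
  (\forall h \near (0 : 'rV[C]_n), g1 (h + w) = g2 (h + w)) ->
  first_order g1 w l -> first_order g2 w l.
Proof.
move=> g12 g1l eps /g1l; have := nbhs_singleton g12; rewrite add0r => g12w.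
by apply: filterS2 g12 => h -> ; rewrite g12w.
Qed.

Lemma first_order_linear c g1 g2 w l1 l2 :
  first_order g1 w l1 -> first_order g2 w l2 ->
  first_order (fun z => c * g1 z + g2 z) w (fun j => c * l1 j + l2 j).
Proof.
move=> g1l g2l eps eps0.
have c0 : 0 < 2 * (`|c| + 1) by rewrite mulr_gt0// ltr_wpDl.
have := g2l _ (divr_gt0 eps0 (ltr0n _ 2)); have := g1l _ (divr_gt0 eps0 c0).
apply: filterS2 => h h1 h2.
have -> : \sum_j h 0 j * (c * l1 j + l2 j) =
    c * (\sum_j h 0 j * l1 j) + \sum_j h 0 j * l2 j.
  by rewrite mulr_sumr -big_split; apply: eq_bigr => j _ /=; ring.
set s1 := \sum_j _ in h1 *; set s2 := \sum_j _ in h2 *.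
rewrite (_ : _ - _ = c * (g1 (h + w) - g1 w - s1) + (g2 (h + w) - g2 w - s2)).
  apply: le_trans (ler_normD _ _) _.
  rewrite [eps]splitr mulrDl; apply: lerD => //; rewrite normrM.
  apply: le_trans (ler_wpM2l (normr_ge0 c) h1) _.
  rewrite mulrA ler_wpM2r// mulrC mulrAC ler_pdivrMr//.
  rewrite mulrA divfK// ler_wpM2l ?(ltW eps0)// lerDl//.
by ring.
Qed.

End first_order.

Section rkhs_basics.
Variables (R : realType) (T : Type) (X : set T) (K : T -> T -> cplx R).
Variable H : rkhs X K.
Local Notation C := (cplx R).
Local Notation dot := (rkhs_dot H).

Lemma rkhs_eval0 z : X z -> rkhs_eval (0 : H) z = 0.
Proof.
by move=> Xz; rewrite -[0](addrN 0) -scaleN1r addrC rkhs_eval_linear// mulN1r addNr.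
Qed.

Lemma rkhs_evalB (f g : H) z : X z ->
  rkhs_eval (f - g) z = rkhs_eval f z - rkhs_eval g z.
Proof. by move=> Xz; rewrite -scaleN1r addrC rkhs_eval_linear// mulN1r addrC. Qed.

Lemma rkhs_evalZ (c : C) (f : H) z : X z ->
  rkhs_eval (c *: f) z = c * rkhs_eval f z.
Proof. by move=> Xz; rewrite -[c *: f]addr0 rkhs_eval_linear// rkhs_eval0// addr0. Qed.

Lemma rkhs_kernel_family : exists k : T -> H,
  (forall w z, X w -> X z -> rkhs_eval (k w) z = K z w) /\
  (forall f w, X w -> rkhs_eval f w = dot f (k w)).
Proof.
have kP w : exists k : H, X w -> (forall z, X z -> rkhs_eval k z = K z w) /\
    forall f : H, rkhs_eval f w = dot f k.
  have [Xw|nXw] := pselect (X w); last by exists 0.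
  by have [k kK kf] := rkhs_reproducing H Xw; exists k.
have [k {}kP] := choice kP; exists k.
by split=> [w z Xw Xz|f w Xw]; have [] := kP w Xw => // kK _; exact: kK.
Qed.

End rkhs_basics.

Section rkhs_differentiable.
Variables (R : realType) (n : nat) (X : set 'rV[cplx R]_n).
Variables (K : 'rV[cplx R]_n -> 'rV[cplx R]_n -> cplx R) (H : rkhs X K).
Local Notation C := (cplx R).
Variables (w : 'rV[C]_n) (M : C).
Hypothesis Xw : \forall h \near (0 : 'rV[C]_n), X (h + w).
Hypothesis M0 : 0 <= M.
Hypothesis K_second_difference : \forall h \near (0 : 'rV[C]_n),
  `|K (h + w) (h + w) - K (h + w) w - K w (h + w) + K w w| <= M * `|h| ^+ 2.
Hypothesis K_differentiable : forall v, X v -> differentiable (K ^~ v) w.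

Let Xw0 : X w. Proof. by have := nbhs_singleton Xw; rewrite add0r. Qed.

Lemma rkhs_locally_lipschitz : \forall h \near (0 : 'rV[C]_n), forall f : H,
  `|rkhs_eval f (h + w) - rkhs_eval f w| <= sqrtC M * `|f| * `|h|.
Proof.
have [k [kK kf]] := rkhs_kernel_family H.
apply: filterS2 Xw K_second_difference => h Xh Kh f.
rewrite !kf// -linearBr/=; apply: le_trans (dot_le (rkhs_dot_norm (r := H)) _ _) _.
rewrite mulrAC mulrC ler_wpM2r// -(@ler_pXn2r _ 2)// ?nnegrE ?mulr_ge0 ?sqrtC_ge0//.
rewrite exprMn sqrtCK; apply: le_trans Kh.
rewrite -[leLHS]ger0_norm ?exprn_ge0// -rkhs_dot_norm linearBl/= !linearBr/=.
rewrite -!kf// !kK// le_eqVlt; apply/orP; left; apply/eqP; congr (`| _ |); ring.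
Qed.

Lemma rkhs_differentiable (f : H) : differentiable (rkhs_eval f) w.
Proof.
have [k [kK kf]] := rkhs_kernel_family H.
pose A : set H := [set f | exists l, first_order (rkhs_eval f) w l].
suff [l /first_order_differentiable//] : A f.
have Alin c (g1 g2 : H) l1 l2 : first_order (rkhs_eval g1) w l1 ->
    first_order (rkhs_eval g2) w l2 ->
    first_order (rkhs_eval (c *: g1 + g2)) w (fun j => c * l1 j + l2 j).
  move=> gl1 gl2; apply: first_order_near (first_order_linear c gl1 gl2).
  by apply: filterS Xw => h Xh; rewrite rkhs_eval_linear.
apply: (closed_submodule_full (rkhs_dot_norm (r := H))).
- have [l ll] := differentiable_first_order (differentiable_cst (0 : C) w).
  exists l; apply: first_order_near ll.
  by apply: filterS Xw => h Xh; rewrite rkhs_eval0.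
- by move=> c g1 g2 [l1 gl1] [l2 gl2]; exists (fun j => c * l1 j + l2 j); exact: Alin.
- move=> g gcl.
  pose T := {f | A f}.
  have [t0 _] : exists t : T, True.
    by have [t At _] := gcl 1 ltr01; exists (exist _ t At).
  have [l lP] := choice (fun t : T => svalP t).
  pose D j : C := `|delta_mx 0 j : 'rV[C]_n|.
  (* By the Lipschitz bound, the [j]-th partial derivatives of two approximations of [g] differ by
     at most [sqrtC M * D j] times the distance between the approximations. *)
  pose e j (t : T) : C := sqrtC M * D j * `|g - sval t|.
  have sM0 : 0 <= sqrtC M by rewrite sqrtC_ge0.
  have Dj0 j : 0 <= D j by exact: normr_ge0.
  have e0 j t : 0 <= e j t by rewrite !mulr_ge0.
  have le j s t : `|l s j - l t j| <= e j s + e j t.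
    have st : first_order (rkhs_eval (sval s - sval t)) w (fun i => l s i - l t i).
      rewrite -scaleN1r addrC.
      rewrite (_ : (fun i => _) = (fun i => -1 * l t i + l s i)); first exact: Alin.
      by apply/funext => i; rewrite mulN1r addrC.
    apply: (@le_trans _ _ (sqrtC M * D j * `|sval s - sval t|)); last first.
      rewrite -mulrDr ler_wpM2l ?mulr_ge0//.
      by rewrite [`|g - _|]distrC; exact: ler_distD.
    apply/ler_addgt0Pr => eps eps0.
    have D0 : 0 < D j + 1 by rewrite ltr_wpDl.
    have st1 : \forall h \near (0 : 'rV[C]_n),
        `|\sum_i (h : 'rV[C]_n) 0 i * (l s i - l t i)| <=
        (sqrtC M * `|sval s - sval t| + eps / (D j + 1)) * `|h|.
      apply: filterS2 (st _ (divr_gt0 eps0 D0)) rkhs_locally_lipschitz => h h1.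
      move=> /(_ (sval s - sval t)) h2; rewrite mulrDl.
      rewrite -[X in `|X|](subKr (rkhs_eval (sval s - sval t) (h + w) -
                      rkhs_eval (sval s - sval t) w)).
      by apply: le_trans (ler_normB _ _) _; exact: lerD.
    (* A single small nonzero multiple of the [j]-th basis vector isolates the [j]-th partial
       derivative. *)
    have [u /= u0 st2] : exists2 u : C, u != 0 &
       `|\sum_i (u *: delta_mx 0 j : 'rV[C]_n) 0 i * (l s i - l t i)| <=
        (sqrtC M * `|sval s - sval t| + eps / (D j + 1)) *
        `|u *: delta_mx 0 j : 'rV[C]_n|.
      have cv : (fun u : C => u *: delta_mx 0 j : 'rV[C]_n) @ (0 : C) --> (0 : 'rV[C]_n).
        rewrite -[X in _ --> X](scale0r (delta_mx 0 j : 'rV[C]_n)).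
        exact: (@scalel_continuous C).
      have st2 := nbhs_dnbhs (cv _ st1).
      have [u [u0 hu]] := filter_ex (filterI (@nbhs_dnbhs_neq C 0) st2).
      by exists u.
    rewrite (bigD1 j)//= big1 ?addr0 in st2; last first.
      by move=> i ij; rewrite !mxE (negPf ij) andbF mulr0 mul0r.
    rewrite !mxE !eqxx mulr1 normrM normrZ mulrCA ler_pM2l ?normr_gt0// in st2.
    apply: le_trans st2 _; rewrite mulrDl mulrAC lerD2l mulrAC ler_pdivrMr//.
    by rewrite ler_wpM2l ?(ltW eps0)// lerDl.
  have [L LP] := choice (fun j => complex_ball_helly t0 (e0 j) (le j)).
  exists L => eps eps0.
  (* [sqrtC M] accounts for the increment of [g - t] and the sum for the error of the gradient, with
     the factor 2 of [complex_ball_helly]. *)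
  pose Q := sqrtC M + \sum_j 2 * (sqrtC M * D j).
  have Q0 : 0 <= Q.
    by rewrite addr_ge0// sumr_ge0// => j _; rewrite !mulr_ge0.
  have Q1 : 0 < 2 * (Q + 1) by rewrite mulr_gt0// ltr_wpDl.
  have [t At gt] := gcl _ (divr_gt0 eps0 Q1).
  pose s : T := exist _ t At.
  have Qt : Q * `|g - t| <= eps / 2.
    rewrite ltr_pdivlMr// in gt; rewrite ler_pdivlMr//; apply: le_trans (ltW gt).
    rewrite mulrAC mulrC ler_wpM2l// mulrC ler_wpM2l//.
    by rewrite lerDl.
  have F1 := lP s _ (divr_gt0 eps0 (ltr0n _ 2)).
  apply: filterS3 Xw F1 rkhs_locally_lipschitz => h Xh /= h1 /(_ (g - t)) h2.
  have -> : rkhs_eval g (h + w) - rkhs_eval g w - \sum_j h 0 j * L j =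
     (rkhs_eval t (h + w) - rkhs_eval t w - \sum_j h 0 j * l s j) +
     ((rkhs_eval (g - t) (h + w) - rkhs_eval (g - t) w) +
      \sum_j h 0 j * (l s j - L j)).
    rewrite !rkhs_evalB// [X in _ + (_ + X)](eq_bigr (fun j => h 0 j * l s j - h 0 j * L j)).
      by rewrite sumrB; ring.
    by move=> j _; rewrite mulrBr.
  apply: le_trans (ler_normD _ _) _.
  rewrite [eps]splitr mulrDl; apply: lerD => //.
  apply: le_trans (ler_wpM2r (normr_ge0 h) Qt).
  rewrite /Q 2!mulrDl; apply: le_trans (ler_normD _ _) _; apply: lerD => //.
  rewrite mulr_suml mulr_suml; apply: le_trans (ler_norm_sum _ _ _) _.
  apply: ler_sum => j _; rewrite normrM mulrC ler_pM// ?coord_le_norm//.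
  by apply: le_trans (LP j s) _; rewrite /e /= mulrA.
- move=> x xorth; apply: (rkhs_eval_inj (r := H)) => v Xv.
  rewrite rkhs_eval0// kf//; apply: xorth.
  have [l ll] := differentiable_first_order (K_differentiable Xv).
  by exists l; apply: first_order_near ll; apply: filterS Xw => h Xh; rewrite kK.
Qed.
End rkhs_differentiable.

(** * Second differences of functions of two variables *)

Section second_difference.
Variable K : numFieldType.

(* a, b, c, d stand for F(w+h,w+h), F(w+h,w), F(w,w+h), F(w,w), and t for |h|. *)
Definition small_quad (M t a b c d : K) :=
  [/\ `|b - d| <= M * t, `|c - d| <= M * t & `|a - b - c + d| <= M * t ^+ 2].

Lemma small_quad_widen (M N t a b c d : K) : 0 <= t -> M <= N ->
  small_quad M t a b c d -> small_quad N t a b c d.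
Proof.
move=> t0 MN [bd cd abcd].
by split; [apply: le_trans bd _|apply: le_trans cd _|apply: le_trans abcd _];
  rewrite ler_wpM2r// exprn_ge0.
Qed.

Lemma small_quadD (M t a b c d a' b' c' d' : K) :
  small_quad M t a b c d -> small_quad M t a' b' c' d' ->
  small_quad (2 * M) t (a + a') (b + b') (c + c') (d + d').
Proof.
move=> [bd cd abcd] [bd' cd' abcd'].
split.
- rewrite (_ : _ - _ = (b - d) + (b' - d')); last by ring.
  by apply: le_trans (ler_normD _ _) _; rewrite -mulrA mulr_natl mulr2n lerD.
- rewrite (_ : _ - _ = (c - d) + (c' - d')); last by ring.
  by apply: le_trans (ler_normD _ _) _; rewrite -mulrA mulr_natl mulr2n lerD.
- rewrite (_ : _ + _ = (a - b - c + d) + (a' - b' - c' + d')); last by ring.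
  by apply: le_trans (ler_normD _ _) _; rewrite -mulrA mulr_natl mulr2n lerD.
Qed.

Lemma small_quad_near (M t a b c d : K) : 0 <= M -> 0 <= t <= 1 ->
  small_quad M t a b c d -> `|a - d| <= 3 * M * t.
Proof.
move=> M0 /andP[t0 t1] [bd cd abcd].
rewrite (_ : _ - _ = (b - d) + (c - d) + (a - b - c + d)); last by ring.
have -> : 3 * M * t = M * t + M * t + M * t by ring.
apply: le_trans (ler_normD _ _) _; apply: lerD.
  by apply: le_trans (ler_normD _ _) _; exact: lerD.
apply: le_trans abcd _; rewrite ler_wpM2l// expr2.
exact: ler_piMr.
Qed.

Lemma small_quadM (M t a b c d a' b' c' d' : K) :
  0 <= M -> 0 <= t <= 1 -> `|d| <= M -> `|d'| <= M ->
  small_quad M t a b c d -> small_quad M t a' b' c' d' ->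
  small_quad (10 * M ^+ 2) t (a * a') (b * b') (c * c') (d * d').
Proof.
move=> M0 t01 dM dM' q q'; have /andP[t0 t1] := t01.
have Mt : M * t <= M by exact: ler_piMr.
have norm2 (x y X Y : K) : `|x| <= X -> `|y| <= Y -> `|x * y| <= X * Y.
  by move=> xX yY; rewrite normrM ler_pM.
have le2 (x y X Y : K) : `|x| <= X -> `|y| <= Y -> `|x + y| <= X + Y.
  by move=> xX yY; apply: le_trans (ler_normD _ _) _; exact: lerD.
have side (x y x' y' : K) : `|y| <= M -> `|x' - y'| <= M * t -> `|y'| <= M ->
    `|x - y| <= M * t -> `|x * x' - y * y'| <= 10 * M ^+ 2 * t.
  move=> yM xy' yM' xy.
  rewrite (_ : _ - _ = (x - y) * (x' - y') + ((x - y) * y' + y * (x' - y'))); last by ring.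
  apply: le_trans (le2 _ _ _ _ (norm2 _ _ _ _ xy (le_trans xy' Mt))
    (le2 _ _ _ _ (norm2 _ _ _ _ xy yM') (norm2 _ _ _ _ yM xy'))) _.
  rewrite (_ : _ + _ = 3 * (M ^+ 2 * t)); last by ring.
  rewrite -mulrA ler_wpM2r ?mulr_ge0 ?exprn_ge0// ler_nat.
  by [].
have [bd cd abcd] := q; have [bd' cd' abcd'] := q'.
split; [exact: side|exact: side|].
have aM' : `|a'| <= 4 * M.
  rewrite -(subrK d' a') (_ : 4 * M = 3 * M + M); last by ring.
  apply: (le2) => //; apply: le_trans (small_quad_near M0 t01 q') _.
  by rewrite -mulrA ler_wpM2l.
have bcM : `|b + c - d| <= 3 * M.
  rewrite (_ : _ - _ = (b - d) + ((c - d) + d)); last by ring.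
  rewrite (_ : 3 * M = M + (M + M)); last by ring.
  by do 2?apply: (le2) => //; apply: le_trans Mt.
(* A Leibniz rule for second differences. The four summands contribute 1, 1, 4 and 3 times
   [M ^+ 2 * t ^+ 2], in total 9. *)
rewrite (_ : _ + _ = ((b - d) * (c' - d') + (c - d) * (b' - d')) +
  ((a - b - c + d) * a' + (b + c - d) * (a' - b' - c' + d'))); last by ring.
apply: le_trans (le2 _ _ _ _ (le2 _ _ _ _ (norm2 _ _ _ _ bd cd')
    (norm2 _ _ _ _ cd bd'))
  (le2 _ _ _ _ (norm2 _ _ _ _ abcd aM') (norm2 _ _ _ _ bcM abcd'))) _.
rewrite (_ : _ + _ = 9 * (M ^+ 2 * t ^+ 2)); last by ring.
by rewrite -mulrA ler_wpM2r ?mulr_ge0 ?exprn_ge0// ler_nat.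
Qed.

(** The bound on [3 * M * t] keeps all four values at least [|d| / 2] in modulus, so their inverses
    are at most [m]. *)
Lemma small_quadV (M m t a b c d : K) :
  0 <= M -> 0 <= t <= 1 -> d != 0 -> 2 * `|d|^-1 = m -> 3 * M * t <= `|d| / 2 ->
  small_quad M t a b c d ->
  small_quad (M * m ^+ 2 + 3 * M ^+ 2 * m ^+ 3) t a^-1 b^-1 c^-1 d^-1.
Proof.
move=> M0 t01 d0 md td q; have /andP[t0 t1] := t01.
have nd0 : 0 < `|d| by rewrite normr_gt0.
have m0 : 0 <= m by rewrite -md mulr_ge0// invr_ge0.
have inv (x : K) : `|x - d| <= 3 * M * t -> x != 0 /\ `|x^-1| <= m.
  move=> /le_trans/(_ td) xd.
  have dx : `|d| / 2 <= `|x|.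
    have : `|d| <= `|x| + `|d| / 2.
      rewrite -{1}(subKr x d); apply: le_trans (ler_normB _ _) _.
      by rewrite lerD2l.
    by rewrite {1}[`|d|]splitr lerD2r.
  have x0 : 0 < `|x| by apply: lt_le_trans dx; rewrite divr_gt0.
  split; first by rewrite -normr_gt0.
  have -> : m = (`|d| / 2)^-1 by rewrite -md invfM invrK mulrC.
  by rewrite normfV lef_pV2 ?posrE ?divr_gt0.
have M3 : M * t <= 3 * M * t by rewrite -mulrA ler_peMl ?mulr_ge0// ler1n.
have [bd cd abcd] := q.
have [a0 am] := inv a (small_quad_near M0 t01 q).
have [b0 bm] := inv b (le_trans bd M3).
have [c0 cm] := inv c (le_trans cd M3).
have [_ dm] : d != 0 /\ `|d^-1| <= m by apply: inv; rewrite subrr normr0 !mulr_ge0.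
have norm2 (x y X Y : K) : `|x| <= X -> `|y| <= Y -> `|x * y| <= X * Y.
  by move=> xX yY; rewrite normrM ler_pM.
have le2 (x y X Y : K) : `|x| <= X -> `|y| <= Y -> `|x + y| <= X + Y.
  by move=> xX yY; apply: le_trans (ler_normD _ _) _; exact: lerD.
have le_tot s : 0 <= s -> M * s * m * m <= (M * m ^+ 2 + 3 * M ^+ 2 * m ^+ 3) * s.
  move=> s0; rewrite (_ : M * s * m * m = M * m ^+ 2 * s); last by ring.
  by rewrite mulrDl lerDl !mulr_ge0 ?exprn_ge0.
have side (x : K) : x != 0 -> `|x^-1| <= m -> `|x - d| <= M * t ->
    `|x^-1 - d^-1| <= (M * m ^+ 2 + 3 * M ^+ 2 * m ^+ 3) * t.
  move=> x0 xm xd; rewrite distrC.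
  rewrite (_ : _ - _ = (x - d) * x^-1 * d^-1); last by field; rewrite d0 x0.
  apply: le_trans (le_tot _ t0).
  by do 2?apply: (norm2).
split; [exact: side|exact: side|].
(* Every summand is of second order in [t]: the first contains the second difference, the others two
   factors of size [M * t]. In the last one the second difference is such a factor, as [t <= 1]. *)
rewrite (_ : _ + _ = - (a - b - c + d) * a^-1 * b^-1 +
  (((c - d) * (b - d) * (a^-1 * c^-1 * d^-1) + (c - d) * (b - d) * (a^-1 * b^-1 * d^-1)) +
  (c - d) * (a - b - c + d) * (a^-1 * c^-1 * d^-1))); last first.
  by field; rewrite a0 b0 c0 d0.
have abcd1 : `|a - b - c + d| <= M * t.
  by apply: le_trans abcd _; rewrite ler_wpM2l// expr2 ler_piMr.
have abcdN : `|- (a - b - c + d)| <= M * t ^+ 2 by rewrite normrN.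
apply: le_trans (le2 _ _ _ _ (norm2 _ _ _ _ (norm2 _ _ _ _ abcdN am) bm)
  (le2 _ _ _ _ (le2 _ _ _ _
    (norm2 _ _ _ _ (norm2 _ _ _ _ cd bd) (norm2 _ _ _ _ (norm2 _ _ _ _ am cm) dm))
    (norm2 _ _ _ _ (norm2 _ _ _ _ cd bd) (norm2 _ _ _ _ (norm2 _ _ _ _ am bm) dm)))
    (norm2 _ _ _ _ (norm2 _ _ _ _ cd abcd1) (norm2 _ _ _ _ (norm2 _ _ _ _ am cm) dm)))) _.
by rewrite le_eqVlt; apply/orP; left; apply/eqP; ring.
Qed.
End second_difference.

Section second_difference_bounded.
Variables (K : numFieldType) (V : normedModType K) (w : V).
Implicit Types F G : V -> V -> K.

(** The first-order bounds inside [small_quad] are what makes this class stable under products and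
    inverses. *)
Definition second_difference_bounded F := exists2 M, 0 <= M &
  \forall h \near (0 : V),
    small_quad M `|h| (F (h + w) (h + w)) (F (h + w) w) (F w (h + w)) (F w w).

Lemma near0_norm_le (e : K) : 0 < e -> \forall h \near (0 : V), `|h| <= e.
Proof.
move=> e0; apply: filterS (nbhsx_ballx (0 : V) _ e0) => h.
by rewrite -ball_normE /= sub0r normrN => /ltW.
Qed.

Lemma second_difference_cst (c : K) : second_difference_bounded (fun _ _ => c).
Proof.
exists 0 => //; near=> h.
by split; rewrite ?subrr ?sub0r ?addNr normr0 mul0r.
Unshelve. all: by end_near. Qed.

Lemma second_differenceD F G : second_difference_bounded F ->
  second_difference_bounded G ->
  second_difference_bounded (fun z v => F z v + G z v).
Proof.
move=> [M M0 FM] [N N0 GN]; exists (2 * (M + N)); first by rewrite mulr_ge0 ?addr_ge0.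
apply: filterS2 FM GN => h Fh Gh; apply: small_quadD.
  by apply: small_quad_widen Fh; rewrite ?lerDl.
by apply: small_quad_widen Gh; rewrite ?lerDr.
Qed.

Lemma second_differenceM F G : second_difference_bounded F ->
  second_difference_bounded G ->
  second_difference_bounded (fun z v => F z v * G z v).
Proof.
(* [small_quadM] takes one bound for everything: [B] dominates both constants and both values at
   [w]. *)
move=> [M M0 FM] [N N0 GN]; pose B := M + N + (`|F w w| + `|G w w|).
have B0 : 0 <= B by rewrite !addr_ge0.
exists (10 * B ^+ 2); first by rewrite mulr_ge0 ?exprn_ge0.
apply: filterS3 FM GN (near0_norm_le ltr01) => h Fh Gh h1.
apply: small_quadM => //.
- by rewrite normr_ge0.
- by rewrite /B [`|F w w| + _]addrC addrA lerDr !addr_ge0.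
- by rewrite /B addrA lerDr !addr_ge0.
- by apply: small_quad_widen Fh; rewrite // /B -addrA lerDl !addr_ge0.
- by apply: small_quad_widen Gh; rewrite // /B [M + N]addrC -addrA lerDl !addr_ge0.
Qed.

Lemma second_differenceV F : F w w != 0 -> second_difference_bounded F ->
  second_difference_bounded (fun z v => (F z v)^-1).
Proof.
move=> F0 [M M0 FM]; set m := 2 * `|F w w|^-1.
have m0 : 0 <= m by rewrite mulr_ge0// invr_ge0.
exists (M * m ^+ 2 + 3 * M ^+ 2 * m ^+ 3).
  by rewrite addr_ge0// !mulr_ge0// exprn_ge0.
(* Within this radius [3 * M * |h|] is at most [|F w w| / 2]; the added 1 covers [M = 0]. *)
have e0 : 0 < `|F w w| / 2 / (3 * M + 1).
  by rewrite !divr_gt0// ?normr_gt0// ltr_wpDl// mulr_ge0.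
apply: filterS3 FM (near0_norm_le ltr01) (near0_norm_le e0) => h Fh h1 he.
apply: small_quadV => //; first by rewrite normr_ge0.
rewrite ler_pdivlMr in he; last by rewrite ltr_wpDl// mulr_ge0.
by apply: le_trans he; rewrite mulrC ler_wpM2l// lerDl.
Qed.

Lemma second_differenceX F n : second_difference_bounded F ->
  second_difference_bounded (fun z v => F z v ^+ n).
Proof.
move=> FM; elim: n => [|n IH]; first exact: second_difference_cst.
rewrite (_ : (fun z v => _) = fun z v => F z v * F z v ^+ n).
  exact: second_differenceM.
by apply/funext => z; apply/funext => v; rewrite exprS.
Qed.

Lemma second_difference_sum (I : Type) (s : seq I) (F : I -> V -> V -> K) :
  (forall i, second_difference_bounded (F i)) ->
  second_difference_bounded (fun z v => \sum_(i <- s) F i z v).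
Proof.
move=> FM; elim: s => [|i s IH].
  rewrite (_ : (fun z v => _) = fun z v => 0); first exact: second_difference_cst.
  by apply/funext => z; apply/funext => v; rewrite big_nil.
rewrite (_ : (fun z v => _) = fun z v => F i z v + \sum_(i <- s) F i z v).
  exact: second_differenceD.
by apply/funext => z; apply/funext => v; rewrite big_cons.
Qed.

Lemma second_difference_prod (I : Type) (s : seq I) (F : I -> V -> V -> K) :
  (forall i, second_difference_bounded (F i)) ->
  second_difference_bounded (fun z v => \prod_(i <- s) F i z v).
Proof.
move=> FM; elim: s => [|i s IH].
  rewrite (_ : (fun z v => _) = fun z v => 1); first exact: second_difference_cst.
  by apply/funext => z; apply/funext => v; rewrite big_nil.
rewrite (_ : (fun z v => _) = fun z v => F i z v * \prod_(i <- s) F i z v).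
  exact: second_differenceM.
by apply/funext => z; apply/funext => v; rewrite big_cons.
Qed.

End second_difference_bounded.

(** The second difference is exactly [|h 0 j|^2]. In the constant [|w| + 1], the first term serves
    the first differences and the 1 serves the second. *)
Lemma second_difference_coord (R : realType) (n : nat) (w : 'rV[cplx R]_n)
    (j : 'I_n) :
  second_difference_bounded w (fun z v : 'rV[cplx R]_n => z 0 j * (v 0 j)^*).
Proof.
exists (`|w| + 1); first by rewrite addr_ge0.
near=> h; rewrite !mxE rmorphD/=; set x := h 0 j; set y := w 0 j.
have xh : `|x| <= `|h| by exact: coord_le_norm.
have yw : `|y| <= `|w| + 1.
  by apply: (le_trans (coord_le_norm w 0 j)); rewrite lerDl.
split.
- rewrite (_ : _ - _ = y^* * x); last by ring.
  by rewrite normrM norm_conjC ler_pM.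
- rewrite (_ : _ - _ = y * x^*); last by ring.
  by rewrite normrM norm_conjC ler_pM.
- rewrite (_ : _ + _ = x * x^*); last by ring.
  rewrite -normCK normrX normr_id -[leLHS]mul1r ler_pM// ?exprn_ge0//.
    by rewrite lerDr.
  by rewrite lerXn2r ?nnegrE.
Unshelve. all: by end_near. Qed.

(** * Differentiability of powers, products and sums *)

Section differentiable_big.
Variables (K : numFieldType) (V : normedModType K) (w : V).

Lemma differentiable_exp (f : V -> K) n :
  differentiable f w -> differentiable (fun z => f z ^+ n) w.
Proof.
case: n => [|n] df; first exact: differentiable_cst.
have := differentiableX n df.
by rewrite (_ : f ^+ n.+1 = fun z => f z ^+ n.+1)// exprfctE.
Qed.

Lemma differentiable_prod (I : Type) (s : seq I) (F : I -> V -> K) :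
  (forall i, differentiable (F i) w) ->
  differentiable (fun z => \prod_(i <- s) F i z) w.
Proof.
move=> dF; elim: s => [|i s IH].
  rewrite (_ : (fun z => _) = cst 1); first exact: differentiable_cst.
  by apply/funext => z; rewrite big_nil.
rewrite (_ : (fun z => _) = F i * (fun z => \prod_(i <- s) F i z)).
  exact: differentiableM.
by apply/funext => z; rewrite big_cons.
Qed.

Lemma differentiable_sum_seq (I : Type) (s : seq I) (F : I -> V -> K) :
  (forall i, differentiable (F i) w) ->
  differentiable (fun z => \sum_(i <- s) F i z) w.
Proof.
move=> dF; elim: s => [|i s IH].
  rewrite (_ : (fun z => _) = cst 0); first exact: differentiable_cst.
  by apply/funext => z; rewrite big_nil.
rewrite (_ : (fun z => _) = F i + (fun z => \sum_(i <- s) F i z)).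
  exact: differentiableD.
by apply/funext => z; rewrite big_cons.
Qed.

End differentiable_big.

(** * The space on the polydisc *)

Section admissible_tuple.
Variables (R : realType) (n : nat) (P : 'I_n -> mpoly.mpoly n (cplx R)).
Local Notation C := (cplx R).
Hypothesis Padm : admissible P.

Lemma peval_admissible j (z : 'rV[C]_n) :
  peval (P j) z =
  \sum_(a <- mpoly.msupp (P j))
    mpoly.mcoeff a (P j) * z 0 j ^+ mpoly.fun_of_multinom a j.
Proof.
have [_ _ _ _ Pj] := Padm j.
rewrite /peval mpoly.mevalE; apply: eq_bigr => a _.
have [->|a0] := eqVneq (mpoly.mcoeff a (P j)) 0; first by rewrite !mul0r.
rewrite (bigD1 j)//= big1 ?mulr1// => i ij.
by rewrite (Pj a).
Qed.

Lemma PtildeE j s : Ptilde P j s =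
  \sum_(a <- mpoly.msupp (P j))
    mpoly.mcoeff a (P j) * s ^+ mpoly.fun_of_multinom a j.
Proof. by rewrite /Ptilde peval_admissible !mxE !eqxx mulr1. Qed.

Lemma peval_Ptilde j (z : 'rV[C]_n) : peval (P j) z = Ptilde P j (z 0 j).
Proof. by rewrite PtildeE peval_admissible. Qed.

Lemma Ptilde_le_norm j s t : `|s| <= t -> `|Ptilde P j s| <= Ptilde P j t.
Proof.
move=> st; have [P0 _ _ _ _] := Padm j; rewrite !PtildeE.
apply: le_trans (ler_norm_sum _ _ _) _; apply: ler_sum => a _.
rewrite normrM ger0_norm// normrX ler_wpM2l// lerXn2r// nnegrE//.
exact: le_trans st.
Qed.

Lemma Ptilde_ge0 j s : 0 <= s -> 0 <= Ptilde P j s.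
Proof.
move=> s0; have := @Ptilde_le_norm j s s; rewrite ger0_norm// => /(_ (lexx s)).
exact: le_trans.
Qed.

Lemma discE j s : disc P j s = (Ptilde P j (`|s| ^+ 2) < 1) :> Prop.
Proof. by rewrite /disc /= ger0_norm// Ptilde_ge0// exprn_ge0. Qed.

Lemma Ptilde_neq1 j s t : disc P j s -> disc P j t ->
  1 - Ptilde P j (s * t^*) != 0.
Proof.
move=> ds dt; suff : `|Ptilde P j (s * t^*)| < 1.
  by rewrite subr_eq0; apply: contraTneq => <-; rewrite normr1 ltxx.
(* Both products have modulus at most the square of the larger modulus [|v|], where [Ptilde] is
   below 1. *)
have key (u v : C) : disc P j v -> `|u| <= `|v| -> `|Ptilde P j (u * v^*)| < 1 /\ 
   `|Ptilde P j (v * u^*)| < 1.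
  move=> dv uv; rewrite discE in dv.
  by split; apply: le_lt_trans dv; apply: Ptilde_le_norm;
    rewrite normrM norm_conjC expr2 ler_pM.
have [st|ts] := real_leP (normr_real s) (normr_real t); first by have [] := key _ _ dt st.
by have [] := key _ _ ds (ltW ts).
Qed.

Lemma differentiable_Ptilde j s : differentiable (Ptilde P j : C -> C) s.
Proof.
rewrite (_ : Ptilde P j = fun s : C => \sum_(a <- mpoly.msupp (P j))
    mpoly.mcoeff a (P j) * s ^+ mpoly.fun_of_multinom a j); last first.
  by apply/funext => t; rewrite PtildeE.
apply: differentiable_sum_seq => a.
apply: differentiableM; first exact: differentiable_cst.
exact: differentiable_exp.
Qed.

Lemma continuous_Ptilde_norm j (w : 'rV[C]_n) :
  {for (0 : 'rV[C]_n),
    continuous (fun h : 'rV[C]_n => Ptilde P j (`|(h + w) 0 j| ^+ 2) : C)}.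
Proof.
have cN : {for (0 : 'rV[C]_n), continuous (fun h : 'rV[C]_n => `|(h + w) 0 j| : C)}.
  apply: (@continuous_comp _ _ _ (fun h : 'rV[C]_n => (h + w) 0 j : C) (fun x : C => `|x|)).
    apply: differentiable_continuous.
    rewrite (_ : (fun h => _) = (fun h : 'rV[C]_n => h 0 j : C) + cst (w 0 j)).
      by apply: differentiableD; [exact: differentiable_coord|exact: differentiable_cst].
    by apply/funext => h; rewrite mxE.
  exact: norm_continuous.
have cN2 : {for (0 : 'rV[C]_n), continuous (fun h : 'rV[C]_n => `|(h + w) 0 j| ^+ 2 : C)}.
  exact: (continuousM cN cN).
apply: (continuous_comp cN2).
exact/differentiable_continuous/differentiable_Ptilde.
Qed.

(** In the partial order of [K], closeness to [p] alone does not make [q] comparable with 1;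
    nonnegativity identifies [q] with its norm. *)
Lemma lt1_of_dist (K : numFieldType) (p q : K) : 0 <= p -> 0 <= q ->
  `|p - q| < 1 - p -> q < 1.
Proof.
move=> p0 q0 pq; rewrite -(ger0_norm q0) -[X in `|X|](subrK p).
apply: le_lt_trans (ler_normD _ _) _; rewrite distrC -ltrBrDr.
by rewrite [`|p|]ger0_norm.
Qed.

Lemma disc_nbhs j (w : 'rV[C]_n) : disc P j (w 0 j) ->
  \forall h \near (0 : 'rV[C]_n), disc P j ((h + w) 0 j).
Proof.
rewrite discE -subr_gt0.
move/cvgrPdist_lt: (@continuous_Ptilde_norm j w); rewrite add0r => /[apply] wj.
apply: filterS wj => h /= hw; rewrite discE.
by apply: lt1_of_dist hw; rewrite Ptilde_ge0// exprn_ge0.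
Qed.

Lemma polydisc_nbhs (w : 'rV[C]_n) : polydisc P w ->
  \forall h \near (0 : 'rV[C]_n), polydisc P (h + w).
Proof.
move=> wD.
apply: (@filter_forall _ _ (fun j => [set h : 'rV[C]_n | disc P j ((h + w) 0 j)])
  (nbhs (0 : 'rV[C]_n))) => j.
exact: disc_nbhs.
Qed.

Variable m : 'I_n -> nat.

Lemma polydisc_kernel_second_difference (w : 'rV[C]_n) : polydisc P w ->
  second_difference_bounded w (polydisc_kernel P m).
Proof.
move=> wD; apply: second_difference_prod => j.
apply: second_differenceV; first by rewrite expf_neq0// Ptilde_neq1.
apply: second_differenceX.
rewrite (_ : (fun z v => _) = fun z v : 'rV[C]_n => 1 + \sum_(a <- mpoly.msupp (P j))
    - mpoly.mcoeff a (P j) * (z 0 j * (v 0 j)^*) ^+ mpoly.fun_of_multinom a j).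
  apply: second_differenceD; first exact: second_difference_cst.
  apply: second_difference_sum => a; apply: second_differenceM.
    exact: second_difference_cst.
  exact/second_differenceX/second_difference_coord.
apply/funext => z; apply/funext => v; rewrite PtildeE -sumrN.
by congr (_ + _); apply: eq_bigr => a _; rewrite mulNr.
Qed.

Lemma polydisc_kernel_differentiable (v w : 'rV[C]_n) : polydisc P v ->
  polydisc P w -> differentiable (polydisc_kernel P m ^~ v) w.
Proof.
move=> vD wD; apply: differentiable_prod => j.
apply: differentiableV; last by rewrite expf_neq0// Ptilde_neq1.
apply: differentiable_exp.
rewrite (_ : (fun z => _) = cst 1 - (fun z : 'rV[C]_n => \sum_(a <- mpoly.msupp (P j))
    mpoly.mcoeff a (P j) * (z 0 j * (v 0 j)^*) ^+ mpoly.fun_of_multinom a j)).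
  apply: differentiableB; first exact: differentiable_cst.
  apply: differentiable_sum_seq => a.
  apply: differentiableM; first exact: differentiable_cst.
  apply: differentiable_exp; apply: differentiableM; last exact: differentiable_cst.
  exact: differentiable_coord.
by apply/funext => z; rewrite PtildeE.
Qed.

Lemma polydisc_rkhs_holomorphic (H : rkhs (polydisc P) (polydisc_kernel P m)) f :
  holomorphic_on (polydisc P) (rkhs_eval (f : H)).
Proof.
move=> w wD.
have [M M0 KM] := polydisc_kernel_second_difference wD.
apply: (@rkhs_differentiable _ _ _ _ H w M) => //.
- exact: polydisc_nbhs.
- by apply: filterS KM => h [].
- by move=> v vD; apply: polydisc_kernel_differentiable.
Qed.

End admissible_tuple.

(** * The change of variables *)

Section phi_algebra.
Variables (R : realType) (n : nat).
Local Notation C := (cplx R).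
Implicit Types z w : 'rV[C]_n.

(** Preserved by both [phi] and [phi_inv], the condition serves on either side. The coordinate of
    index 0 may vanish. *)
Definition off_axes z := forall j : 'I_n, (0 < j)%N -> z 0 j != 0.

(** This recursion follows the [insub] in [phi], so that quotients of consecutive coordinates
    telescope. *)
Lemma phi_inv_rec z (j : 'I_n) : phi_inv z 0 j =
  z 0 j * (if insub j.+1 is Some k then phi_inv z 0 (k : 'I_n) else 1).
Proof.
rewrite !mxE (bigD1 j)//=; congr (_ * _).
case: insubP => [k _ kj|jn].
  rewrite mxE; apply: eq_bigl => l.
  by rewrite kj andbC [in RHS]ltn_neqAle eq_sym.
rewrite big1// => l /andP[jl lj]; case/negP: jn.
by apply: leq_ltn_trans (ltn_ord l); rewrite ltn_neqAle jl eq_sym lj.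
Qed.

Lemma off_axes_phi_inv z : off_axes z -> off_axes (phi_inv z).
Proof.
move=> z0 j j0; rewrite mxE; apply/prodf_neq0 => k jk.
by apply: z0; exact: leq_trans jk.
Qed.

Lemma off_axes_phi z : off_axes z -> off_axes (phi z).
Proof.
move=> z0 j j0; rewrite mxE; case: insubP => [k _ kj|_]; last exact: z0.
by rewrite mulf_neq0 ?invr_eq0 ?z0 ?kj.
Qed.

Lemma phi_invK z : off_axes z -> phi (phi_inv z) = z.
Proof.
move=> z0; apply/rowP => j; rewrite mxE phi_inv_rec.
case: insubP => [k _ kj|_]; last by rewrite mulr1.
by rewrite mulfK// off_axes_phi_inv// kj.
Qed.

Lemma phiK z : off_axes z -> phi_inv (phi z) = z.
Proof.
move=> z0; apply/rowP => j.
(* Induction on [n - j] runs downwards from the last index, where [phi] leaves the coordinate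
   unchanged. *)
have [r] := ubnP (n - j); elim: r j => // r IH j jr.
rewrite phi_inv_rec mxE; case: insubP => [k jn kj|_]; last by rewrite mulr1.
rewrite IH ?divfK//; first by rewrite z0 ?kj.
by rewrite kj; apply: (@leq_trans (n - j)); [exact: ltn_sub2l|rewrite -ltnS].
Qed.

(** [z 0 l] is a factor of [phi_inv z 0 j] for [0 < j <= l], that is, for [l] indices: its exponent
    in the Jacobian. This turns the prefactor of the triangle kernel into Jacobians. *)
Lemma prod_phi_inv z :
  \prod_(j < n | (0 < j)%N) phi_inv z 0 j = jac_phi_inv z.
Proof.
rewrite jac_phi_invE; under eq_bigr do rewrite mxE.
rewrite (exchange_big_dep predT)//=; apply: eq_bigr => l _.
rewrite prodr_const; congr (_ ^+ _).
have n0 : (0 < n)%N by exact: leq_ltn_trans (ltn_ord l).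
have cl : #|[pred j : 'I_n | (j < l.+1)%N]| = l.+1.
  by rewrite -sum1_card (big_ord_narrow (ltn_ord l))/= sum1_card card_ord.
rewrite (cardD1 (Ordinal n0)) !inE /= add1n in cl; case: cl => {2}<-.
by apply: eq_card => j; rewrite !inE [LHS]unfold_in ltnS -val_eqE /= lt0n.
Qed.

Lemma jac_phi_inv_neq0 z : off_axes z -> jac_phi_inv z != 0.
Proof.
move=> z0; rewrite jac_phi_invE; apply/prodf_neq0 => j _.
case: (posnP j) => [->|j0]; first by rewrite expr0 oner_neq0.
by rewrite expf_neq0 ?z0.
Qed.

End phi_algebra.

(** * The two kernels and the unitary between their spaces *)

Section unitary_transfer.
Variables (R : realType) (n : nat) (P : 'I_n -> mpoly.mpoly n (cplx R)).
Variable m : 'I_n -> nat.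
Local Notation C := (cplx R).
Hypothesis Padm : admissible P.
Implicit Types z w : 'rV[C]_n.

Lemma peval_diamond j z w :
  peval (P j) (diamond z (conj_row w)) = Ptilde P j (z 0 j * (w 0 j)^*).
Proof. by rewrite (peval_Ptilde Padm) !mxE. Qed.

Lemma triangleP w : triangle P w <-> off_axes w /\ polydisc P (phi w).
Proof.
by split=> -[w0 wD]; split=> // j; have := wD j;
  rewrite (discE Padm) peval_diamond -normCK.
Qed.

Lemma phi_triangleP z : (@phi R n @` triangle P) z <-> off_axes z /\ polydisc P z.
Proof.
split=> [[w /triangleP[w0 wD] <-]|[z0 zD]].
  by split=> //; exact: off_axes_phi.
exists (phi_inv z); last exact: phi_invK.
by apply/triangleP; rewrite phi_invK//; split=> //; exact: off_axes_phi_inv.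
Qed.

Lemma triangle_kernel_phi_inv z w : off_axes z -> off_axes w ->
  triangle_kernel P m (phi_inv z) (phi_inv w) =
  (jac_phi_inv z * (jac_phi_inv w)^*)^-1 * polydisc_kernel P m z w.
Proof.
move=> z0 w0; rewrite /triangle_kernel /polydisc_kernel (phi_invK z0) (phi_invK w0).
rewrite prodfV big_split /= -rmorph_prod !prod_phi_inv.
by apply: congr1; apply: eq_bigr => j _; rewrite peval_diamond.
Qed.

(** Move from [z] along the vector with all coordinates 1: for small [t != 0] a zero coordinate
    becomes [t] and a nonzero one stays nonzero. Continuity at [t = 0] concludes. *)
Lemma off_axes_dense (g1 g2 : 'rV[C]_n -> C) :
  holomorphic_on (polydisc P) g1 -> holomorphic_on (polydisc P) g2 ->
  (forall z, off_axes z -> polydisc P z -> g1 z = g2 z) ->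
  forall z, polydisc P z -> g1 z = g2 z.
Proof.
move=> dg1 dg2 g12 z zD; pose o : 'rV[C]_n := const_mx 1.
pose line (t : C) : 'rV[C]_n := t *: o + z.
have line0 : line 0 = z by rewrite /line scale0r add0r.
have dline : differentiable line 0.
  have -> : line = (fun t : C => t *: o) + cst z by [].
  apply: differentiableD; last exact: differentiable_cst.
  by apply: (@differentiableZl _ _ _ (fun t : C => t)).
pose g (t : C) : C := g1 (line t) - g2 (line t).
have dg : differentiable g 0.
  have dgl (f : 'rV[C]_n -> C) : differentiable f z -> differentiable (f \o line) 0.
    by move=> df; apply: differentiable_comp; [exact: dline|rewrite line0; exact: df].
  have -> : g = (g1 \o line) - (g2 \o line) by [].
  by apply: differentiableB; apply: dgl; [exact: dg1|exact: dg2].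
have nearD : \forall t \near (0 : C)^', polydisc P (line t).
  apply: nbhs_dnbhs.
  have cv : (fun t : C => t *: o) @ (0 : C) --> (0 : 'rV[C]_n).
    by rewrite -[X in _ --> X](scale0r o); exact: (@scalel_continuous C).
  exact: (cv _ (polydisc_nbhs Padm zD)).
have nearA : \forall t \near (0 : C)^', off_axes (line t).
  suff nearj (j : 'I_n) : \forall t \near (0 : C)^', (0 < j)%N -> line t 0 j != 0.
    exact: filter_forall nearj.
  have [zj|zj] := eqVneq (z 0 j) 0.
    apply: filterS (@nbhs_dnbhs_neq C 0) => t t0 _.
    by rewrite !mxE zj addr0 mulr1.
  apply: nbhs_dnbhs.
  have zj0 : 0 < `|z 0 j| by rewrite normr_gt0.
  apply: filterS (nbhsx_ballx (0 : C) _ zj0) => t.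
  rewrite -ball_normE /= sub0r normrN !mxE mulr1 => tz _.
  by rewrite addr_eq0; apply: contraTneq tz => ->; rewrite normrN ltxx.
have g0 : g 0 = 0.
  (* If [g 0] were nonzero, continuity would keep [g] within [|g 0|] of it, yet [g] vanishes at
     points arbitrarily near 0. *)
  apply: contrapT => /eqP; rewrite -normr_gt0 => gn0.
  have := differentiable_continuous dg; rewrite /continuous_at.
  move=> /cvgrPdist_lt/(_ _ gn0)/nbhs_dnbhs nearg.
  have [t [gt [tA tD]]] := filter_ex (filterI nearg (filterI nearA nearD)).
  by move: gt; rewrite /= {2}/g g12// subrr subr0 ltxx.
by apply/subr0_eq; rewrite -[z]line0.
Qed.

Section spaces.
Variables (H1 : rkhs (triangle P) (triangle_kernel P m)).
Variables (H2 : rkhs (polydisc P) (polydisc_kernel P m)).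

Lemma polydisc_rkhs_eq (f g : H2) :
  (forall z, off_axes z -> polydisc P z -> rkhs_eval f z = rkhs_eval g z) -> f = g.
Proof.
move=> fg; apply: (rkhs_eval_inj (r := H2)) => z zD.
by apply: off_axes_dense zD => //; exact: polydisc_rkhs_holomorphic.
Qed.

Lemma triangle_polydisc_unitary : exists Psi : {linear H1 -> H2},
  is_unitary_op Psi /\
  forall f z, off_axes z -> polydisc P z ->
    rkhs_eval (Psi f) z = jac_phi_inv z * rkhs_eval f (phi_inv z).
Proof.
have [k1 [k1K k1E]] := rkhs_kernel_family H1.
have [k2 [k2K k2E]] := rkhs_kernel_family H2.
pose I := {z | off_axes z /\ polydisc P z}.
pose a (i : I) := k1 (phi_inv (sval i)).
pose b (i : I) := ((jac_phi_inv (sval i))^*)^-1 *: k2 (sval i).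
have phiI (i : I) : triangle P (phi_inv (sval i)).
  have [z0 zD] := svalP i; apply/triangleP; rewrite phi_invK//.
  by split=> //; exact: off_axes_phi_inv.
have aE f i : rkhs_dot H1 f (a i) = rkhs_eval f (phi_inv (sval i)).
  by rewrite k1E.
have bE f i : rkhs_dot H2 f (b i) = (jac_phi_inv (sval i))^-1 * rkhs_eval f (sval i).
  have [_ zD] := svalP i.
  rewrite linearZr_LR/= k2E//.
  by rewrite -fmorphV [_^*^*]conjCK.
have [|||U [Ubij Udot Ueval]] := @gram_unitary R H1 H2 (rkhs_dot H1) (rkhs_dot H2) I a b
  (@rkhs_dot_norm _ _ _ _ H1) (@rkhs_dot_norm _ _ _ _ H2).
- move=> i j; have [zi0 ziD] := svalP i; have [zj0 zjD] := svalP j.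
  rewrite aE bE /a k1K// triangle_kernel_phi_inv// rkhs_evalZ// k2K//.
  by rewrite invfM mulrA.
(* Every point of the triangle is [phi_inv] of its image under [phi], so [f] vanishes on the whole
   triangle. *)
- move=> f fa; apply: (rkhs_eval_inj (r := H1)) => w wT; rewrite rkhs_eval0//.
  have /triangleP[w0 wD] := wT; have wI := conj (off_axes_phi w0) wD.
  have := fa (exist _ (phi w) wI).
  by rewrite aE /= phiK.
- move=> f fb; apply: polydisc_rkhs_eq => z z0 zD; rewrite rkhs_eval0//.
  have := fb (exist _ z (conj z0 zD)); rewrite bE /= => /eqP.
  by rewrite mulf_eq0 invr_eq0 (negPf (jac_phi_inv_neq0 z0)) => /eqP.
exists U; split=> // f z z0 zD.
have := Ueval f (exist _ z (conj z0 zD)); rewrite aE bE /= => <-.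
by rewrite mulrA divff ?mul1r// jac_phi_inv_neq0.
Qed.

End spaces.
End unitary_transfer.

(** * Intertwining of the multiplication operators *)

Lemma rkhs_eval_prod_mult (R : realType) (T : Type) (X : set T)
    (K : T -> T -> cplx R) (H : rkhs X K) (I : Type) (r : seq I) (Q : pred I)
    (s : I -> T -> cplx R) (M : I -> {linear H -> H}) (z : T) (f : H) :
  (forall i, is_mult_op (s i) (M i)) -> X z ->
  rkhs_eval ((\big[(fun A B : H -> H => A \o B)/id]_(i <- r | Q i) M i) f) z =
  (\prod_(i <- r | Q i) s i z) * rkhs_eval f z.
Proof.
move=> Ms Xz; elim/big_rec2: _ f => [|i c A _ IH] f; first by rewrite mul1r.
by rewrite /= (Ms i).2// IH mulrA.
Qed.

Theorem proposition8p3 (R : realType) (n : nat)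
    (P : 'I_n -> mpoly.mpoly n (cplx R)) (m : 'I_n -> nat)
    (H1 : rkhs (triangle P) (triangle_kernel P m))
    (H2 : rkhs (polydisc P) (polydisc_kernel P m)) :
  (1 < n)%N ->
  admissible P ->
  (forall j : 'I_n, (0 < m j)%N) ->
  (forall f : H1, holomorphic_on (triangle P) (rkhs_eval f)) ->
  exists Psi : {linear H1 -> H2},
    [/\ (forall f : H1,
           is_holomorphic_extension (@phi R n @` triangle P) (polydisc P)
             (fun z : 'rV[cplx R]_n => jac_phi_inv z * rkhs_eval f (phi_inv z))
             (rkhs_eval (Psi f))),
        is_unitary_op Psi &
        forall (M1 : 'I_n -> {linear H1 -> H1})
               (M2 : 'I_n -> {linear H2 -> H2}),
          (forall j, is_mult_op (fun z : 'rV[cplx R]_n => z 0 j) (M1 j)) ->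
          (forall j, is_mult_op (fun z : 'rV[cplx R]_n => z 0 j) (M2 j)) ->
          forall j : 'I_n,
            Psi \o M1 j =
            (\big[(fun A B : H2 -> H2 => A \o B)/id]_(k < n | (j <= k)%N) M2 k)
              \o Psi].
Proof.
move=> _ Padm _ _; have [Psi [Psiu PsiE]] := triangle_polydisc_unitary Padm H1 H2.
have PsiH f : holomorphic_on (polydisc P) (rkhs_eval (Psi f)).
  exact: polydisc_rkhs_holomorphic.
exists Psi; split=> // [f|M1 M2 M1E M2E j].
  split=> // [z /phi_triangleP-/(_ Padm)[z0 zD]|g' g'H g'E]; first exact: PsiE.
  (* Two holomorphic extensions agree off the axes, hence on the whole polydisc. *)
  apply: (off_axes_dense Padm g'H (PsiH f)) => z z0 zD.
  by rewrite g'E ?PsiE//; apply/phi_triangleP.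
apply/funext => f; apply: (polydisc_rkhs_eq Padm) => z z0 zD.
have zT : triangle P (phi_inv z).
  apply/(triangleP Padm); rewrite (phi_invK z0).
  by split; [exact: off_axes_phi_inv|exact: zD].
(* The multiplier [z 0 j], taken at [phi_inv z], is the product of the [z 0 k] with [j <= k]:
   exactly the multiplier of the composed operators on the other side. *)
rewrite /= (rkhs_eval_prod_mult _ _ _ M2E zD) !PsiE// (M1E j).2// mxE.
by rewrite mulrCA.
Qed.
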